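(* Let $\mathcal{C}$ be a super-modular category with minimal modular extensions $\check{\mathcal{C}}_\nu$, $\nu\in\mathbb{Z}/16$, and let $\rho_{\bf g}:\mathcal{C}\to\mathcal{C}$ be a unitary topological autoequivalence. If $(\nu_1,\nu_2)$ is any pair for which there exists a map $\check{\rho}_{\bf g}:\check{\mathcal{C}}_{\nu_1}\to\check{\mathcal{C}}_{\nu_2}$ lifting $\rho_{\bf g}$, then $\nu_1=\nu_2$.
   Context: A super-modular category $\mathcal{C}$ is a unitary braided fusion category with exactly one nontrivial simple object $\psi$ that braids trivially with all objects, where $\psi$ is a fermion: topological twist $\theta_\psi=-1$ and $\psi\times\psi=1$. A minimal modular extension $\check{\mathcal{C}}$ of $\mathcal{C}$ is a unitary modular tensor category (UMTC) containing $\mathcal{C}$ as a full braided fusion subcategory, with total quantum dimension satisfying $\mathcal{D}_{\check{\mathcal{C}}}^2=2\mathcal{D}_{\mathcal{C}}^2$. Every super-modular category has exactly 16 minimal modular extensions $\check{\mathcal{C}}_\nu$, $\nu\in\{0,\dots,15\}$, and their chiral central charges $c_\nu$ (defined mod 8 by the Gauss sum $\mathcal{D}^{-1}\sum_a d_a^2\theta_a=e^{2\pi i c_\nu/8}$) satisfy $c_\nu-c_{\nu'}=(\nu-\nu')/2 \bmod 8$. A unitary topological autoequivalence is a braided autoequivalence (it preserves $F$- and $R$-symbols up to a change of basis of fusion spaces). A lift $\check{\rho}_{\bf g}:\check{\mathcal{C}}_{\nu_1}\to\check{\mathcal{C}}_{\nu_2}$ of a unitary $\rho_{\bf g}$ is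 a unitary braided equivalence from $\check{\mathcal{C}}_{\nu_1}$ to $\check{\mathcal{C}}_{\nu_2}$ (hence preserving fusion rules, quantum dimensions and topological twists) that restricts to (a representative of the class of) $\rho_{\bf g}$ on $\mathcal{C}$. *)

(* Defs.v *)
From mathcomp Require Import all_boot all_order all_algebra.
From mathcomp Require Import all_classical all_reals all_analysis.
From mathcomp Require Import complex sesquilinear.

Set Implicit Arguments.
Unset Strict Implicit.
Unset Printing Implicit Defensive.

Import Order.TTheory GRing.Theory Num.Theory.
Local Open Scope ring_scope.
Local Open Scope sesquilinear_scope.

(* Rectangular on purpose: the two sizes will be fusion multiplicities that are
   only provably equal; the two equations together force m = n.               *)
Definition unitary_mx (R : realType) (m n : nat) (A : 'M[R[i]]_(m, n)) : Prop :=
  A *m A ^t* = 1%:M /\ A ^t* *m A = 1%:M.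

(* Bases of Hom(d, (a b) c) and of Hom(d, a (b c)):
   (e; alpha, beta) and (f; mu, nu) respectively.                             *)
Definition lidx (L : finType) (N : L -> L -> L -> nat) (a b c d : L) : finType :=
  {e : L & ('I_(N a b e) * 'I_(N e c d))%type}.

Definition ridx (L : finType) (N : L -> L -> L -> nat) (a b c d : L) : finType :=
  {f : L & ('I_(N b c f) * 'I_(N a f d))%type}.

(* Unitary braided fusion categories in skeletal form, i.e. given by their
   F- and R-symbols.  The simple objects are the labels, N a b c is the
   dimension of the fusion space V^{ab}_c, in which an orthonormal basis is
   chosen, and
     [F^{abc}_d]_{(e,alpha,beta),(f,mu,nu)} = Fsym e alpha beta f mu nu,
     [R^{ab}_c]_{alpha,beta} = Rsym a b c alpha beta
   express, respectively, the basis of V^{ab}_e (x) V^{ec}_d in that of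
   V^{bc}_f (x) V^{af}_d, and the basis of V^{ab}_c in that of V^{ba}_c.
   Associativity of the fusion rules follows from unitarity of F, and their
   commutativity from unitarity of R.                                         *)
Record ubfc (R : realType) := UBFC {
  label :> finType;
  one : label;
  dual : label -> label;
  N : label -> label -> label -> nat;
  Fmat : forall a b c d : label, lidx N a b c d -> ridx N a b c d -> R[i];
  Rsym : forall a b c : label, 'M[R[i]]_(N a b c, N b a c);
  Fsym := fun (a b c d e : label) (al : 'I_(N a b e)) (be : 'I_(N e c d))
              (f : label) (mu : 'I_(N b c f)) (nu : 'I_(N a f d)) =>
    @Fmat a b c d (existT _ e (al, be)) (existT _ f (mu, nu));
  N1l : forall a c, N one a c = (a == c);
  N1r : forall a c, N a one c = (a == c);
  N_dual : forall a b, N a b one = (b == dual a);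
  F_unitaryr : forall a b c d (x y : lidx N a b c d),
    \sum_z @Fmat a b c d x z * (@Fmat a b c d y z)^* = (x == y)%:R;
  F_unitaryl : forall a b c d (x y : ridx N a b c d),
    \sum_z (@Fmat a b c d z x)^* * @Fmat a b c d z y = (x == y)%:R;
  R_unitary : forall a b c, unitary_mx (Rsym a b c);
  (* the bases of V^{1a}_a and V^{a1}_a are those given by the unitors *)
  F_unitl : forall a b c (al : 'I_(N one a a)) (be : 'I_(N a b c))
                   (mu : 'I_(N a b c)) (nu : 'I_(N one c c)),
    @Fsym one a b c a al be c mu nu = (be == mu)%:R;
  F_unitm : forall a b c (al : 'I_(N a one a)) (be : 'I_(N a b c))
                   (mu : 'I_(N one b b)) (nu : 'I_(N a b c)),
    @Fsym a one b c a al be b mu nu = (be == nu)%:R;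
  F_unitr : forall a b c (al : 'I_(N a b c)) (be : 'I_(N c one c))
                   (mu : 'I_(N b one b)) (nu : 'I_(N a b c)),
    @Fsym a b one c c al be b mu nu = (al == nu)%:R;
  pentagon : forall (a b c d e f g l k : label)
      (al : 'I_(N a b f)) (be : 'I_(N f c g)) (ga : 'I_(N g d e))
      (nu : 'I_(N c d l)) (la : 'I_(N b l k)) (mu : 'I_(N a k e)),
    \sum_(de : 'I_(N f l e))
      @Fsym f c d e g be ga l nu de * @Fsym a b l e f al de k la mu
    = \sum_(h : label) \sum_(si : 'I_(N b c h)) \sum_(ps : 'I_(N a h g))
        \sum_(rh : 'I_(N h d k))
        @Fsym a b c g f al be h si ps * @Fsym a h d e g ps ga k rh mu
          * @Fsym b c d k h si rh l nu la;
  hexagon : forall (a b c d e g : label)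
      (al : 'I_(N c a e)) (be : 'I_(N e b d))
      (mu : 'I_(N b c g)) (nu : 'I_(N a g d)),
    \sum_(la : 'I_(N a c e)) \sum_(ga : 'I_(N c b g))
      Rsym c a e al la * @Fsym a c b d e la be g ga nu * Rsym c b g ga mu
    = \sum_(f : label) \sum_(de : 'I_(N a b f)) \sum_(si : 'I_(N c f d))
        \sum_(ps : 'I_(N f c d))
        @Fsym c a b d e al be f de si * Rsym c f d si ps
          * @Fsym a b c d f de ps g mu nu;
  (* the same for the inverse braiding: R^-1 is the adjoint of R *)
  hexagon_inv : forall (a b c d e g : label)
      (al : 'I_(N c a e)) (be : 'I_(N e b d))
      (mu : 'I_(N b c g)) (nu : 'I_(N a g d)),
    \sum_(la : 'I_(N a c e)) \sum_(ga : 'I_(N c b g))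
      (Rsym a c e) ^t* al la * @Fsym a c b d e la be g ga nu
        * (Rsym b c g) ^t* ga mu
    = \sum_(f : label) \sum_(de : 'I_(N a b f)) \sum_(si : 'I_(N c f d))
        \sum_(ps : 'I_(N f c d))
        @Fsym c a b d e al be f de si * (Rsym f c d) ^t* si ps
          * @Fsym a b c d f de ps g mu nu;
  (* Rigidity: with a' = dual a, [F^{aa'a}_a]_{1,1} is, up to normalisation, the
     composite a -> (a a') a -> a (a' a) -> a of coevaluation and evaluation.
     All four multiplicities are 1, so the sum has a single term.             *)
  rigid : forall a,
    \sum_(al : 'I_(N a (dual a) one)) \sum_(be : 'I_(N one a a))
      \sum_(mu : 'I_(N (dual a) a one)) \sum_(nu : 'I_(N a one a))
      @Fsym a (dual a) a a one al be one mu nu != 0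
}.

Arguments one {R} u.
Arguments dual {R} [u] a.
Arguments N {R} [u] a b c.
Arguments Fsym {R} [u] [a b c d] e al be f mu nu.
Arguments Rsym {R} [u] a b c.

Section Invariants.
Variables (R : realType) (C : ubfc R).

(* d_a = | [F^{aa'a}_a]_{1,1} |^{-1}; the sum has a single term *)
Definition qdim (a : C) : R[i] :=
  `| \sum_(al : 'I_(N a (dual a) (one C))) \sum_(be : 'I_(N (one C) a a))
       \sum_(mu : 'I_(N (dual a) a (one C))) \sum_(nu : 'I_(N a (one C) a))
       Fsym (one C) al be (one C) mu nu |^-1.

Definition total_qdim2 : R[i] := \sum_(a : C) qdim a ^+ 2.

(* d_a theta_a is the quantum trace of the self-braiding of a *)
Definition twist (a : C) : R[i] :=
  \sum_(c : C) qdim c / qdim a * \tr (Rsym a a c).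

Definition transparent (a : C) : Prop :=
  forall b c : C, Rsym a b c *m Rsym b a c = 1%:M.

(* quantum trace of the double braiding of a and b *)
Definition smat_entry (a b : C) : R[i] :=
  \sum_(c : C) qdim c * \tr (Rsym a b c *m Rsym b a c).

Definition Smatrix : 'M[R[i]]_#|C| :=
  \matrix_(i, j) smat_entry (enum_val i) (enum_val j).

Definition modular : Prop := Smatrix \in unitmx.

Definition super_modular : Prop :=
  exists psi : C,
    [/\ psi != one C, transparent psi,
        (forall a : C, a != one C -> transparent a -> a = psi),
        twist psi = -1
      & forall c : C, N psi psi c = (c == one C)].

Definition is_central_charge (x : R) : Prop :=
  (sqrtC total_qdim2)^-1 * (\sum_(a : C) qdim a ^+ 2 * twist a)
  = (cos (2 * pi * x / 8) +i* sin (2 * pi * x / 8))%C.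

End Invariants.

(* The data of a functor taking simple objects to simple objects: a map of
   labels, and the matrices of the induced maps of fusion spaces V^{ab}_c,
   i.e. the changes of basis of fusion spaces.                                *)
Record prefunctor (R : realType) (A B : ubfc R) := Prefunctor {
  on_label :> A -> B;
  on_fusion : forall a b c : A,
    'M[R[i]]_(N a b c, N (on_label a) (on_label b) (on_label c))
}.

Definition comp_prefunctor (R : realType) (A B D : ubfc R)
    (g : prefunctor B D) (f : prefunctor A B) : prefunctor A D :=
  @Prefunctor R A D (fun a => g (f a))
    (fun a b c => on_fusion f a b c *m on_fusion g (f a) (f b) (f c)).

(* Unitary braided monoidal fully faithful functors.  The third clause says that
   the image is closed under tensor products.  The normalisation of u^{1a}_a and
   u^{a1}_a is not imposed: compatibility with F^{a1b} makes them one and the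
   same scalar, which is the structure isomorphism of the units.              *)
Record braided_embedding (R : realType) (A B : ubfc R) (f : prefunctor A B)
    : Prop := BraidedEmbedding {
  be_inj : injective f;
  be_one : f (one A) = one B;
  be_closed : forall (a b : A) (c' : B),
    (0 < N (f a) (f b) c')%N -> exists c : A, f c = c';
  be_unitary : forall a b c : A, unitary_mx (on_fusion f a b c);
  be_F : forall (a b c d e : A) (al : 'I_(N a b e)) (be : 'I_(N e c d))
      (k : A) (mu : 'I_(N (f b) (f c) (f k))) (nu : 'I_(N (f a) (f k) (f d))),
    \sum_al' \sum_be'
      on_fusion f a b e al al' * on_fusion f e c d be be'
        * Fsym (f e) al' be' (f k) mu nu
    = \sum_mu' \sum_nu'
        Fsym e al be k mu' nu'
          * on_fusion f b c k mu' mu * on_fusion f a k d nu' nu;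
  be_R : forall a b c : A,
    on_fusion f a b c *m Rsym (f a) (f b) (f c)
    = Rsym a b c *m on_fusion f b a c
}.

Definition braided_equivalence (R : realType) (A B : ubfc R)
    (f : prefunctor A B) : Prop :=
  braided_embedding f /\ forall b : B, exists a : A, f a = b.

(* Unitary monoidal natural isomorphism: f and g agree on labels and differ by
   phases gamma_a on the simple objects a.  The equality of the column indices
   j, j' is stated on their values since their types are only provably equal. *)
Definition nat_iso (R : realType) (A B : ubfc R) (f g : prefunctor A B) : Prop :=
  (forall a : A, f a = g a) /\
  exists2 gamma : A -> R[i], (forall a, `|gamma a| = 1)
    & forall (a b c : A) (i : 'I_(N a b c))
        (j : 'I_(N (f a) (f b) (f c))) (j' : 'I_(N (g a) (g b) (g c))),
        j = j' :> nat ->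
        on_fusion f a b c i j
        = gamma a * gamma b / gamma c * on_fusion g a b c i j'.

Record min_mod_ext (R : realType) (C : ubfc R) := MinModExt {
  ext :> ubfc R;
  incl : prefunctor C ext;
  incl_embedding : braided_embedding incl;
  ext_modular : modular ext;
  ext_minimal : total_qdim2 ext = 2 * total_qdim2 C
}.

Definition is_lift (R : realType) (C : ubfc R) (rho : prefunctor C C)
    (E1 E2 : min_mod_ext C) (rhoc : prefunctor E1 E2) : Prop :=
  braided_equivalence rhoc /\
  nat_iso (comp_prefunctor rhoc (incl E1)) (comp_prefunctor (incl E2) rho).

Definition ext_equiv (R : realType) (C : ubfc R) (E1 E2 : min_mod_ext C) : Prop :=
  exists2 phi : prefunctor E1 E2, braided_equivalence phi
    & nat_iso (comp_prefunctor phi (incl E1)) (incl E2).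

(* E is an indexing of the sixteen minimal modular extensions of C (up to
   equivalence of extensions), and c nu is the chiral central charge of E nu;
   the last clause is c nu - c nu' = (nu - nu') / 2 mod 8, which does not depend
   on the representatives of nu, nu' in Z/16.                                 *)
Record sixteenfold_way (R : realType) (C : ubfc R)
    (E : 'Z_16 -> min_mod_ext C) (c : 'Z_16 -> R) : Prop := SixteenfoldWay {
  sw_enum : forall X : min_mod_ext C, exists! nu, ext_equiv X (E nu);
  sw_charge : forall nu, is_central_charge (E nu) (c nu);
  sw_diff : forall nu nu' : 'Z_16, exists k : int,
    c nu - c nu' = ((nu : nat)%:R - (nu' : nat)%:R) / 2 + 8 * k%:~R
}.

(* Main.v *)
Require Import Defs.
From mathcomp Require Import all_boot all_order all_algebra.
From mathcomp Require Import all_classical all_reals all_analysis.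
From mathcomp Require Import complex sesquilinear.
From mathcomp Require Import zify lra.

(** The Gauss sum of a braided fusion category is built from quantum dimensions
    and twists. Both are gauge invariant (a quantum dimension is the modulus of
    an F-symbol between one-dimensional fusion spaces, a twist is a combination
    of traces of R-symbols), so a unitary braided equivalence preserves the
    Gauss sum, hence the central charge modulo 8. As the sixteen central charges
    differ by half-integers (nu - nu') / 2 with |nu - nu'| < 16, they are
    pairwise distinct modulo 8. *)

Set Implicit Arguments.
Unset Strict Implicit.
Unset Printing Implicit Defensive.

Import Order.TTheory GRing.Theory Num.Theory.
Local Open Scope ring_scope.
Local Open Scope sesquilinear_scope.

Lemma periodicz (U V : zmodType) (f : U -> V) (T : U) :
  periodic f T -> forall (k : int) (a : U), f (a + T *~ k) = f a.
Proof.
move=> fT [n|n] a; first exact: periodicn.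
by rewrite -[in RHS](subrK (T *+ n.+1) a) periodicn.
Qed.

(** Shift [x] by a multiple of 2 pi to some [y] in [0, 2 pi); injectivity of [cos] on [0, pi] then
    forces [y = 0]. *)
Lemma cos_eq1 (R : realType) (x : R) :
  cos x = 1 -> exists k : int, x = (pi *+ 2) *~ k.
Proof.
move=> cosx; have pi0 := @pi_gt0 R.
have tpi0 : 0 < pi *+ 2 :> R by rewrite pmulrn_lgt0.
pose k := Num.floor (x / (pi *+ 2)); pose y := x + (pi *+ 2) *~ (- k).
have xE : x = y + (pi *+ 2) *~ k by rewrite /y mulrNz subrK.
have cosy : cos y = 1 by rewrite /y (periodicz (@cosD2pi R)).
have y0 : 0 <= y.
  rewrite /y mulrNz subr_ge0 -mulrzr mulrC -ler_pdivlMr //.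
  exact: floor_le.
have ylt : y < pi *+ 2.
  rewrite /y mulrNz ltrBlDr -mulrzr -{1}[pi *+ 2]mulr1 -mulrDr mulrC.
  rewrite -ltr_pdivrMr //.
  have := floorD1_gt (x / (pi *+ 2)); rewrite -/k intrD addrC; apply.
exists k; rewrite xE; clearbody y.
suff -> : y = 0 by rewrite add0r.
have [ypi|piy] := leP y pi.
  by apply: cos_inj; rewrite ?in_itv /= ?y0 ?lexx ?(ltW pi0) ?cos0.
(* For [y] beyond pi, the reflection 2 pi - y lies in [0, pi] and has the same cosine, so it would
   be 0, against [ylt]. *)
suff : - y + pi *+ 2 = 0 by lra.
apply: cos_inj; rewrite ?in_itv /= ?lexx ?(ltW pi0) //.
  by apply/andP; split; lra.
by rewrite cosD2pi cosN cos0.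
Qed.

Section UnitaryMatrices.
Variables (R : realType) (m n : nat) (A : 'M[R[i]]_(m, n)).
Hypothesis A_unitary : unitary_mx A.

Lemma unitary_mx_square : m = n.
Proof.
case: A_unitary => /mulmx1_min mn /mulmx1_min nm.
by apply/eqP; rewrite eqn_leq mn nm.
Qed.

Lemma unitary_mx_norm1 (i : 'I_m) (j : 'I_n) : m = 1%N -> `|A i j| = 1.
Proof.
have := unitary_mx_square; case: A_unitary => AA _ mn m1; subst m.
move: A i j AA; rewrite m1 => B i j /matrixP /(_ i i).
rewrite !mxE eqxx big_ord1 !mxE !ord1 /= => BB.
by apply/eqP; rewrite -sqrp_eq1 ?normr_ge0 // normCK BB.
Qed.

(** [Y] is the conjugate of [X] by [A]. With [be_R] at equal objects this makes the traces in
    [twist] gauge invariant. *)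
Lemma mxtrace_unitary_conj (X : 'M[R[i]]_m) (Y : 'M[R[i]]_n) :
  A *m Y = X *m A -> \tr Y = \tr X.
Proof.
case: A_unitary => AA' A'A AY.
by rewrite -[Y]mul1mx -A'A -mulmxA AY mxtrace_mulC -mulmxA AA' mulmx1.
Qed.

End UnitaryMatrices.

(** Meant for fusion multiplicities, which equal 1 only provably. *)
Lemma sum_ord1 (V : nmodType) (n : nat) (F : 'I_n -> V) (i0 : 'I_n) :
  n = 1%N -> \sum_i F i = F i0.
Proof.
by move=> n1; subst n; rewrite big_ord1 (ord1 i0).
Qed.

Section FusionRules.
Variables (R : realType) (C : ubfc R).

Lemma NC (a b c : C) : N a b c = N b a c.
Proof. exact: unitary_mx_square (R_unitary a b c). Qed.

Lemma N_dualr (a : C) : N a (dual a) (Defs.one C) = 1%N.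
Proof. by rewrite N_dual eqxx. Qed.

Lemma N_duall (a : C) : N (dual a) a (Defs.one C) = 1%N.
Proof. by rewrite NC N_dualr. Qed.

Lemma N_onel (a : C) : N (Defs.one C) a a = 1%N.
Proof. by rewrite N1l eqxx. Qed.

Lemma N_oner (a : C) : N a (Defs.one C) a = 1%N.
Proof. by rewrite N1r eqxx. Qed.

End FusionRules.

Section BraidedEmbedding.
Variables (R : realType) (A B : ubfc R) (f : prefunctor A B).
Hypothesis f_emb : braided_embedding f.

Lemma on_label_N (a b c : A) : N (f a) (f b) (f c) = N a b c.
Proof. by rewrite (unitary_mx_square (be_unitary f_emb a b c)). Qed.

(** By [N_dual], only the dual of [f a] fuses with [f a] to the unit, and [f] preserves both
    multiplicities and unit. *)
Lemma on_label_dual (a : A) : f (dual a) = dual (f a).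
Proof.
apply/eqP; have := N_dual (f a) (f (dual a)).
by rewrite -(be_one f_emb) on_label_N N_dualr; case: eqP.
Qed.

(** All fusion spaces involved are lines, so [be_F] equates the two F-symbols up to factors of
    modulus 1. *)
Lemma on_label_qdim (a : A) : qdim (f a) = qdim a.
Proof.
rewrite /qdim -on_label_dual -(be_one f_emb); congr (_ ^-1).
have N1 := N_dualr a; have N2 := N_onel a.
have N3 := N_duall a; have N4 := N_oner a.
(* The only index of a one-dimensional fusion space. *)
pose o n (n1 : n = 1%N) : 'I_n := cast_ord (esym n1) ord0.
have f1 b c d : N b c d = 1%N -> N (f b) (f c) (f d) = 1%N.
  by rewrite on_label_N.
have u1 b c d i j : N b c d = 1%N -> `|on_fusion f b c d i j| = 1.
  exact: (unitary_mx_norm1 (be_unitary f_emb b c d) i j).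
rewrite (sum_ord1 _ (o _ N1)) // (sum_ord1 _ (o _ N2)) //.
rewrite (sum_ord1 _ (o _ N3)) // (sum_ord1 _ (o _ N4)) //.
rewrite (sum_ord1 _ (o _ (f1 _ _ _ N1))) ?on_label_N //.
rewrite (sum_ord1 _ (o _ (f1 _ _ _ N2))) ?on_label_N //.
rewrite (sum_ord1 _ (o _ (f1 _ _ _ N3))) ?on_label_N //.
rewrite (sum_ord1 _ (o _ (f1 _ _ _ N4))) ?on_label_N //.
have := be_F f_emb (o _ N1) (o _ N2) (o _ (f1 _ _ _ N3)) (o _ (f1 _ _ _ N4)).
rewrite (sum_ord1 _ (o _ (f1 _ _ _ N1))) ?on_label_N //.
rewrite (sum_ord1 _ (o _ (f1 _ _ _ N2))) ?on_label_N //.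
rewrite (sum_ord1 _ (o _ N3)) // (sum_ord1 _ (o _ N4)) //.
move/(congr1 Num.norm); rewrite !normrM.
by rewrite !u1 // !mul1r !mulr1.
Qed.

End BraidedEmbedding.

Section BraidedEquivalence.
Variables (R : realType) (A B : ubfc R) (f : prefunctor A B).
Hypothesis f_equiv : braided_equivalence f.

Lemma on_label_bij : bijective f.
Proof.
case: f_equiv => f_emb f_surj; have [g fg] := choice f_surj.
by exists g => // a; apply: (be_inj f_emb).
Qed.

Lemma on_label_twist (a : A) : twist (f a) = twist a.
Proof.
have [f_emb _] := f_equiv.
rewrite /twist (reindex f) /=; last exact: onW_bij on_label_bij.
apply: eq_bigr => c _; rewrite !on_label_qdim //; congr (_ * _).
exact: (mxtrace_unitary_conj (be_unitary f_emb a a c) (be_R f_emb a a c)).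
Qed.

Lemma total_qdim2_equiv : total_qdim2 B = total_qdim2 A.
Proof.
have [f_emb _] := f_equiv.
rewrite /total_qdim2 (reindex f) /=; last exact: onW_bij on_label_bij.
by apply: eq_bigr => a _; rewrite on_label_qdim.
Qed.

Lemma is_central_charge_equiv (x : R) :
  is_central_charge B x -> is_central_charge A x.
Proof.
have [f_emb _] := f_equiv.
rewrite /is_central_charge total_qdim2_equiv (reindex f) /=; last first.
  exact: onW_bij on_label_bij.
by under eq_bigr => a _ do rewrite on_label_qdim // on_label_twist.
Qed.

End BraidedEquivalence.

(** Both numbers are the argument of the same normalised Gauss sum, so the cosine of the difference
    of the two angles is 1. *)
Lemma is_central_charge_mod8 (R : realType) (A : ubfc R) (x y : R) :
  is_central_charge A x -> is_central_charge A y ->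
  exists k : int, x - y = 8 * k%:~R.
Proof.
rewrite /is_central_charge => -> [cosxy sinxy].
have : cos (2 * pi * x / 8 - 2 * pi * y / 8) = 1.
  by rewrite cosB cosxy sinxy -!expr2 cos2Dsin2.
move=> /cos_eq1[k]; rewrite -mulrzr => xy; exists k.
have pi0 : pi != 0 :> R by rewrite gt_eqF ?pi_gt0.
apply: (mulfI pi0); lra.
Qed.

Theorem theoremI2 (R : realType) (C : ubfc R) (C_super : super_modular C)
  (E : 'Z_16 -> min_mod_ext C) (c : 'Z_16 -> R) (E_sixteen : sixteenfold_way E c)
  (rho : prefunctor C C) (rho_equiv : braided_equivalence rho)
  (nu1 nu2 : 'Z_16) :
  (exists rhoc : prefunctor (E nu1) (E nu2), is_lift rho rhoc) -> nu1 = nu2.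
Proof.
move=> [rhoc [rhoc_equiv _]].
(* Pulled back along the lift, [c nu2] is a second central charge of [E nu1]. *)
have c2 := is_central_charge_equiv rhoc_equiv (sw_charge E_sixteen nu2).
have [m cm] := is_central_charge_mod8 (sw_charge E_sixteen nu1) c2.
have [k ck] := sw_diff E_sixteen nu1 nu2.
(* Twice the equation (nu1 - nu2) / 2 + 8 k = 8 m; representatives in 0..15 congruent modulo 16
   coincide. *)
have nuE : (nu1 : nat)%:Z = (nu2 : nat)%:Z + 16 * (m - k).
  apply: (@intr_inj R).
  rewrite !(intrD, intrM, intrB) -!pmulrn; lra.
have nu1_lt : (nu1 < 16)%N := ltn_ord nu1.
have nu2_lt : (nu2 < 16)%N := ltn_ord nu2.
by apply: val_inj => /=; lia.
Qed.
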